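(* Let $(X,d_X)$ and $(Y,d_Y)$ be two finite metric spaces. Then $$\sup_{k\ge 0}\widehat d_{\mathrm B,k}(X,Y)=\sup_{k\ge 0}\ \inf_{(Z,\phi_X,\phi_Y)} d_{\mathrm M}\left(\mathcal{B}_{\mathrm{Ver},k}(Z_X),\mathcal{B}_{\mathrm{Ver},k}(Z_Y)\right)\ \le\ \inf_{(Z,\phi_X,\phi_Y)}\ \sup_{k\ge 0} d_{\mathrm M}\left(\mathcal{B}_{\mathrm{Ver},k}(Z_X),\mathcal{B}_{\mathrm{Ver},k}(Z_Y)\right)=\widehat d_{\mathrm I}(X,Y),$$ where the infima range over all finite tripods $X\twoheadleftarrow Z\twoheadrightarrow Y$ with surjections $\phi_X:Z\to X$, $\phi_Y:Z\to Y$.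
   Context: Fix a field $\mathbb{F}$. Finite (pseudo-)metric spaces are nonempty. Vietoris–Rips FCC. For a finite pseudo-metric space $(X,d_X)$, $C_*(\mathrm{VR}(X))$ is the simplicial chain complex over $\mathbb{F}$ of the full simplex on the vertex set $X$ (points at distance $0$ remain distinct vertices), with filtration function $\ell^X(\sum\lambda_i\sigma_i)=\max_{\lambda_i\ne0}\operatorname{diam}(\sigma_i)$ (distinct simplices $\sigma_i$), $\ell^X(0)=-\infty$. Elements $x_1,\dots,x_r$ are orthogonal if $\ell^X(\sum\lambda_ix_i)=\max_{\lambda_i\ne0}\ell^X(x_i)$ for all scalars. Verbose barcode. For $k\ge0$, choose orthogonal ordered bases $(y_1,\dots,y_n)$ of $C_{k+1}$ and $(x_1,\dots,x_m)$ of $\ker\partial_k$ such that, with $r=\operatorname{rank}\partial_{k+1}$, $(y_{r+1},\dots,y_n)$ is a basis of $\ker\partial_{k+1}$, $(x_1,\dots,x_r)$ is a basis of $\operatorname{im}\partial_{k+1}$, and $\partial_{k+1}y_i=x_i$ for $i\le r$. The degree-$k$ verbose barcode $\mathcal{B}_{\mathrm{Ver},k}(X)$ is the multiset of pairs $(\ell^X(x_i),\ell^X(y_i))$, $i\le r$, and $(\ell^X(x_i),\infty)$, $r<i\le m$. It does not depend on the choices. Matching distance. $\|(p,q)-(p',q')\|_\infty=\max\{|p-p'|,|q-q'|\}$ if $q,q'<\infty$, $|p-p'|$ if $q=q'=\infty$, $\infty$ otherwise. $d_{\mathrm M}(A,B)=\inf_\phi\sup_{a\in A}\|a-\phi(a)\|_\infty$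 over bijections of multisets $\phi:A\to B$ ($\infty$ if cardinalities differ, $0$ if both are empty). Interleaving distance. For filtered chain complexes $(C_*,\ell_C)$, $(D_*,\ell_D)$ put $C_*^t=\{x:\ell_C(x)\le t\}$. They are $\delta$-interleaved if there are chain maps $f_t:C_*^t\to D_*^{t+\delta}$, $g_t:D_*^t\to C_*^{t+\delta}$ ($t\in\mathbb{R}$) commuting with the inclusions, with $g_{t+\delta}f_t$ and $f_{t+\delta}g_t$ equal to the inclusions $C_*^t\hookrightarrow C_*^{t+2\delta}$, $D_*^t\hookrightarrow D_*^{t+2\delta}$; $d_{\mathrm I}$ is the infimum of such $\delta\ge0$. Pullback distances. A finite tripod between $X$ and $Y$ is a finite set $Z$ with surjections $\phi_X:Z\to X$, $\phi_Y:Z\to Y$. $Z_X$ denotes $Z$ with the pseudo-metric $(z,z')\mapsto d_X(\phi_X(z),\phi_X(z'))$; similarly $Z_Y$. Define $\widehat d_{\mathrm B,k}(X,Y)=\inf d_{\mathrm M}(\mathcal{B}_{\mathrm{Ver},k}(Z_X),\mathcal{B}_{\mathrm{Ver},k}(Z_Y))$ and $\widehat d_{\mathrm I}(X,Y)=\inf d_{\mathrm I}(C_*(\mathrm{VR}(Z_X)),C_*(\mathrm{VR}(Z_Y)))$, both infima over finite tripods. *)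

(* Defs.v *)
From HB Require Import structures.
From mathcomp Require Import all_boot all_order all_algebra.
From mathcomp Require Import all_classical all_reals ereal.

Set Implicit Arguments.
Unset Strict Implicit.
Unset Printing Implicit Defensive.

Import Order.TTheory GRing.Theory Num.Theory.

Local Open Scope classical_set_scope.
Local Open Scope ring_scope.

Record finPseudoMetric (R : realType) := FinPseudoMetric {
  point :> finType;
  dist : point -> point -> R;
  point_gt0 : (0 < #|point|)%N;
  dist_ge0 : forall x y, 0 <= dist x y;
  dist_xx : forall x, dist x x = 0;
  dist_sym : forall x y, dist x y = dist y x;
  dist_triangle : forall x y z, dist x z <= dist x y + dist y z
}.

Definition is_metric (R : realType) (X : finPseudoMetric R) : Prop :=
  forall x y : X, dist x y = 0 -> x = y.

Section Pullback.
Context (R : realType) (X : finPseudoMetric R) (Z : finType) (phi : Z -> X).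
Context (phi_surj : forall x, exists z, phi z = x).

Lemma pullback_gt0 : (0 < #|Z|)%N.
Proof.
have /card_gt0P[x _] := point_gt0 X; have [z _] := phi_surj x.
by apply/card_gt0P; exists z.
Qed.

Definition pullback : finPseudoMetric R :=
  @FinPseudoMetric R Z (fun z z' => dist (phi z) (phi z')) pullback_gt0
    (fun _ _ => dist_ge0 _ _) (fun _ => dist_xx _)
    (fun _ _ => dist_sym _ _) (fun _ _ _ => dist_triangle _ _ _).
End Pullback.

Record tripod (R : realType) (X Y : finPseudoMetric R) := Tripod {
  apex : finType;
  tripodX : apex -> X;
  tripodY : apex -> Y;
  tripodX_surj : forall x, exists z, tripodX z = x;
  tripodY_surj : forall y, exists z, tripodY z = y
}.

Definition pullbackX (R : realType) (X Y : finPseudoMetric R)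
    (T : tripod X Y) : finPseudoMetric R :=
  pullback (@tripodX_surj R X Y T).

Definition pullbackY (R : realType) (X Y : finPseudoMetric R)
    (T : tripod X Y) : finPseudoMetric R :=
  pullback (@tripodY_surj R X Y T).

(* The complex is graded over [nat]: [bd C k] is the differential from degree
   [k.+1] to degree [k], and the differential on degree [0] is zero.  The
   filtration function takes values in the reals together with [-oo]. *)
Record filteredComplex (R : realType) (F : fieldType) := FilteredComplex {
  chain : nat -> vectType F;
  bd : forall k, 'Hom(chain k.+1, chain k);
  len : forall k, chain k -> \bar R;
  bd_bd : forall k x, bd k (bd k.+1 x) = 0;
  len_ltey : forall k x, (@len k x < +oo)%E;
  len_eqNy : forall k x, (@len k x == -oo%E) = (x == 0);
  lenZ : forall k a x, a != 0 -> @len k (a *: x) = len x;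
  lenD : forall k x y, (@len k (x + y) <= Order.max (len x) (len y))%E;
  len_bd : forall k x, (@len k (bd k x) <= len x)%E
}.

Section VerboseBarcode.
Context (R : realType) (F : fieldType) (C : filteredComplex R F).

Definition cycles (k : nat) : {vspace chain C k} :=
  match k with
  | 0 => fullv
  | k'.+1 => lker (bd C k')
  end.

Definition orthogonal k (s : seq (chain C k)) : Prop :=
  forall lam : 'I_(size s) -> F,
    len (\sum_(i < size s) lam i *: s`_i) =
    \big[Order.max/-oo%E]_(i < size s | lam i != 0) len s`_i.

Definition singular_bases k (ys : seq (chain C k.+1)) (xs : seq (chain C k)) :
    Prop :=
  let r := \dim (limg (bd C k)) in
  [/\ basis_of fullv ys /\ orthogonal ys,
      basis_of (cycles k) xs /\ orthogonal xs,
      basis_of (lker (bd C k)) (drop r ys),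
      basis_of (limg (bd C k)) (take r xs)
    & [seq bd C k y | y <- take r ys] = take r xs].

(* Multisets of bars are represented by sequences; only notions that are
   invariant under permutation are applied to them. *)
Definition is_verbose_barcode k (B : seq (\bar R * \bar R)) : Prop :=
  exists (ys : seq (chain C k.+1)) (xs : seq (chain C k)),
    singular_bases ys xs /\
    let r := \dim (limg (bd C k)) in
    B = [seq (len p.1, len p.2) | p <- zip (take r xs) (take r ys)] ++
        [seq (len x, +oo%E) | x <- drop r xs].

(* Such bases always exist and the multiset of bars does not depend on them, so
   the default value of [xget] is never used and the barcode is well defined up
   to permutation. *)
Definition verbose_barcode k : seq (\bar R * \bar R) :=
  xget [::] [set B | is_verbose_barcode k B].

End VerboseBarcode.

Definition bar_dist (R : realType) (a b : \bar R * \bar R) : \bar R :=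
  if (a.2 < +oo)%E && (b.2 < +oo)%E then
    Order.max `|a.1 - b.1|%E `|a.2 - b.2|%E
  else if (a.2 == +oo%E) && (b.2 == +oo%E) then `|a.1 - b.1|%E
  else +oo%E.

(* A bijection of multisets is a bijection of positions.  If the sizes differ
   there is none and the infimum is [+oo]; the bars being at nonnegative
   distance, the neutral element [0] only matters when both are empty. *)
Definition matching_dist (R : realType) (A B : seq (\bar R * \bar R)) :
    \bar R :=
  ereal_inf [set d | exists phi : 'I_(size A) -> 'I_(size B), bijective phi /\
    d = \big[Order.max/0%E]_(i < size A)
          bar_dist (tnth (in_tuple A) i) (tnth (in_tuple B) (phi i))].

Section Interleaving.
Context (R : realType) (F : fieldType).
Implicit Types C D : filteredComplex R F.

Definition sublevel C (t : R) k : set (chain C k) :=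
  [set x | (len x <= t%:E)%E].

(* A chain map from the sublevel complex of [C] at [s] to that of [D] at [t]:
   only the values of [f] on the sublevel sets at [s] are meaningful. *)
Definition sublevel_chain_map C D (s t : R)
    (f : forall k, chain C k -> chain D k) : Prop :=
  [/\ forall k x, sublevel s x -> sublevel t (f k x),
      forall k a x y, sublevel s x -> sublevel s y ->
        f k (a *: x + y) = a *: f k x + f k y
    & forall k x, sublevel s x -> f k (bd C k x) = bd D k (f k.+1 x)].

Definition shift_family C D (delta : R)
    (f : R -> forall k, chain C k -> chain D k) : Prop :=
  (forall t, sublevel_chain_map t (t + delta) (f t)) /\
  (forall s t k x, s <= t -> sublevel s x -> f t k x = f s k x).

Definition interleaved C D (delta : R) : Prop :=
  exists (f : R -> forall k, chain C k -> chain D k)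
         (g : R -> forall k, chain D k -> chain C k),
  [/\ shift_family delta f,
      shift_family delta g,
      forall t k (x : chain C k), sublevel t x ->
        g (t + delta) k (f t k x) = x
    & forall t k (y : chain D k), sublevel t y ->
        f (t + delta) k (g t k y) = y].

Definition interleaving_dist C D : \bar R :=
  ereal_inf [set delta%:E | delta in
    [set delta : R | 0 <= delta /\ interleaved C D delta]].

End Interleaving.

Definition simplex (X : finType) (k : nat) := {s : {set X} | #|s| == k.+1}.

Section Boundary.
Context (F : fieldType) (X : finType).

Definition vr_chain (k : nat) : vectType F := {ffun simplex X k -> F^o}.

(* Simplices are oriented by the enumeration order of the vertices. *)
Definition vertex_pos (s : {set X}) (v : X) : nat :=
  #|[set w in s | (enum_rank w < enum_rank v)%N]|.

Definition incidence (s t : {set X}) : F :=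
  \sum_(v in s | s :\ v == t) (-1) ^+ vertex_pos s v.

Definition vr_bd_fun k (c : vr_chain k.+1) : vr_chain k :=
  [ffun t : simplex X k =>
    \sum_(s : simplex X k.+1) c s * incidence (val s) (val t)].

Lemma vr_bd_is_linear k : linear (@vr_bd_fun k).
Proof.
move=> a c c'; apply/ffunP => t; rewrite !ffunE scaler_sumr -big_split /=.
by apply: eq_bigr => s _; rewrite !ffunE mulrDl /GRing.scale /= mulrA.
Qed.

HB.instance Definition _ k :=
  GRing.isLinear.Build F (vr_chain k.+1) (vr_chain k) _ (@vr_bd_fun k)
    (@vr_bd_is_linear k).

Definition vr_bd k : 'Hom(vr_chain k.+1, vr_chain k) := linfun (@vr_bd_fun k).

Lemma vertex_pos_del (s : {set X}) (v w : X) : v \in s ->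
  vertex_pos s w = ((enum_rank v < enum_rank w)%N + vertex_pos (s :\ v) w)%N.
Proof.
move=> vs; rewrite /vertex_pos (cardsD1 v) inE vs /=; congr (_ + _)%N.
by apply: eq_card => u; rewrite !inE andbA.
Qed.

Lemma incidence_incidence k (s : simplex X k.+2) (t : simplex X k) :
  \sum_(u : simplex X k.+1)
    incidence (val s) (val u) * incidence (val u) (val t) = 0.
Proof.
set S := val s; set T := val t.
pose E v w : F := (-1) ^+ vertex_pos S v * (-1) ^+ vertex_pos (S :\ v) w.
pose P v w := [&& v \in S, w \in S, v != w & S :\ v :\ w == T].
have PC v w : P v w = P w v.
  by rewrite /P (eq_sym v w) finset.setDDl finset.setUC -finset.setDDl andbCA.
transitivity (\sum_v \sum_(w | P v w) E v w).
  transitivity (\sum_(v in S) \sum_(w | P v w) E v w); last first.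
    rewrite big_mkcond; apply: eq_bigr => v _; case: ifP => // vS.
    by rewrite big_pred0 // => w; rewrite /P vS.
  under eq_bigr => u _ do rewrite mulr_suml.
  rewrite (exchange_big_dep (mem S)) /=; last by move=> u v _ /andP[].
  apply: eq_bigr => v vS.
  have Sv : #|S :\ v| == k.+2.
    by have := valP s; rewrite /= -/S (cardsD1 v) vS add1n eqSS.
  rewrite (big_pred1 (Sub (S :\ v) Sv)) => [|u]; last first.
    by rewrite vS -val_eqE /= eq_sym.
  rewrite mulr_sumr /=; apply: eq_bigl => w.
  by rewrite /P vS !inE /= (eq_sym w v) -andbA andbCA.
pose lt (v w : X) := (enum_rank v < enum_rank w)%N.
under eq_bigr => v _ do rewrite (bigID (lt v)) /=.
rewrite big_split /= addrC (exchange_big_dep predT) //= -big_split /=.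
apply: big1 => v _; apply/eqP; rewrite addr_eq0 -sumrN; apply/eqP.
apply: eq_big => [w|w /andP[Pwv wv]].
  rewrite PC; case Pvw: (P v w) => //=; move: Pvw => /and4P[_ _ vw _].
  by rewrite /lt -leqNgt leq_eqVlt val_eqE (inj_eq enum_rank_inj) (negPf vw).
move: Pwv wv => /and4P[wS vS wv _]; rewrite /lt -leqNgt leq_eqVlt.
rewrite val_eqE (inj_eq enum_rank_inj) eq_sym (negPf wv) /= => vw.
rewrite /E (vertex_pos_del w vS) vw (vertex_pos_del v wS).
by rewrite ltnNge (ltnW vw) /= add0n add1n exprS mulN1r mulNr mulrC.
Qed.

End Boundary.

Section VietorisRips.
Context (R : realType) (F : fieldType) (X : finPseudoMetric R).

Definition diam (s : {set X}) : R :=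
  \big[Num.max/0]_(v in s) \big[Num.max/0]_(w in s) dist v w.

Definition vr_len k (c : vr_chain F X k) : \bar R :=
  \big[Order.max/-oo%E]_(s : simplex X k | c s != 0) (diam (val s))%:E.

Lemma diamS (s t : {set X}) : s \subset t -> diam s <= diam t.
Proof.
move=> /fintype.subsetP st; apply/bigmax_leP; split=> [|v vs].
  exact: bigmax_ge_id.
apply: (bigmax_sup v _ _ _ (st v vs)); apply/bigmax_leP.
split=> [|w ws]; first exact: bigmax_ge_id.
exact: (bigmax_sup w _ _ _ (st w ws)).
Qed.

Lemma vr_len_leP k (c : vr_chain F X k) (a : \bar R) :
  reflect (forall s : simplex X k, c s != 0 -> ((diam (val s))%:E <= a)%E)
          (vr_len c <= a)%E.
Proof.
by apply: (iffP (bigmax_leP _ _ _ _)) => [[]//|h]; split; rewrite ?leNye.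
Qed.

Lemma vr_len_ge k (c : vr_chain F X k) (s : simplex X k) :
  c s != 0 -> ((diam (val s))%:E <= vr_len c)%E.
Proof. by move=> cs; have /vr_len_leP/(_ s cs) := lexx (vr_len c). Qed.

Lemma vr_bd_bd k (c : vr_chain F X k.+2) :
  vr_bd F X k (vr_bd F X k.+1 c) = 0.
Proof.
rewrite !lfunE; apply/ffunP => t; rewrite !ffunE.
under eq_bigr => u _ do rewrite ffunE mulr_suml.
rewrite exchange_big big1 //= => s _.
under eq_bigr => u _ do rewrite -mulrA.
by rewrite -mulr_sumr incidence_incidence mulr0.
Qed.

Lemma vr_len_ltey k (c : vr_chain F X k) : (vr_len c < +oo)%E.
Proof.
by apply/bigmax_ltP; split=> [|s _]; rewrite ?ltNyr ?ltry // ltNyy.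
Qed.

Lemma vr_len_eqNy k (c : vr_chain F X k) : (vr_len c == -oo%E) = (c == 0).
Proof.
apply/idP/eqP => [/eqP cNy|->].
  apply/ffunP => s; rewrite ffunE; apply/eqP/negPn/negP => cs.
  by have := vr_len_ge cs; rewrite cNy.
by rewrite /vr_len big1_idem // => s; rewrite ffunE eqxx.
Qed.

Lemma vr_lenZ k (a : F) (c : vr_chain F X k) :
  a != 0 -> vr_len (a *: c) = vr_len c.
Proof.
move=> a0; apply: eq_bigl => s.
by rewrite ffunE /GRing.scale /= mulf_eq0 (negPf a0).
Qed.

Lemma vr_lenD k (c c' : vr_chain F X k) :
  (vr_len (c + c') <= Order.max (vr_len c) (vr_len c'))%E.
Proof.
apply/vr_len_leP => s; rewrite ffunE le_max => cc'.
have [cs|/vr_len_ge ->//] := eqVneq (c s) 0.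
by rewrite (@vr_len_ge _ c') ?orbT //; move: cc'; rewrite cs add0r.
Qed.

Lemma vr_len_bd k (c : vr_chain F X k.+1) :
  (vr_len (vr_bd F X k c) <= vr_len c)%E.
Proof.
rewrite lfunE; apply/vr_len_leP => t; rewrite ffunE => bt.
have [s cst] : exists s : simplex X k.+1,
    c s * incidence F (val s) (val t) != 0.
  by apply/existsP; apply: contraNT bt => /existsPn h; rewrite big1 // => s _;
    apply/eqP; have := h s; rewrite negbK.
move: cst; rewrite mulf_eq0 negb_or => /andP[cs ist].
apply: le_trans (vr_len_ge cs); rewrite lee_fin; apply: diamS.
have [v /andP[_ /eqP <-]] : exists v, (v \in val s) && (val s :\ v == val t).
  by apply/existsP; apply: contraNT ist => /existsPn h;
    rewrite /incidence big_pred0 // => v; apply/negbTE/h.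
exact: finset.subD1set.
Qed.

Definition vr_complex : filteredComplex R F :=
  @FilteredComplex R F (vr_chain F X) (vr_bd F X) vr_len vr_bd_bd vr_len_ltey
    vr_len_eqNy vr_lenZ vr_lenD vr_len_bd.

End VietorisRips.

Section PullbackDistances.
Context (R : realType) (F : fieldType) (X Y : finPseudoMetric R).

(* [ereal_inf (range D)] would be ill-typed: [tripod X Y] is too large a type
   for [range]. *)
Definition tripod_inf (D : tripod X Y -> \bar R) : \bar R :=
  ereal_inf [set d | exists T : tripod X Y, D T = d].

Definition pullback_bottleneck_dist (k : nat) : \bar R :=
  tripod_inf (fun T =>
    matching_dist (verbose_barcode (vr_complex F (pullbackX T)) k)
                  (verbose_barcode (vr_complex F (pullbackY T)) k)).

Definition pullback_interleaving_dist : \bar R :=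
  tripod_inf (fun T =>
    interleaving_dist (vr_complex F (pullbackX T))
                      (vr_complex F (pullbackY T))).

End PullbackDistances.

(* Main.v *)
(* For a fixed tripod, the interleaving distance equals the largest matching
   distance, and this holds for any two filtered complexes [C] and [D].
   If the degree-[k] barcodes match within [d] for all [k], mapping singular
   bases to singular bases gives mutually inverse chain maps that change the
   filtration by at most [d].  Conversely, in cycle bases an interleaving gives
   mutually inverse matrices whose nonzero entries bound births and deaths on one
   side, and ordering bars by birth + death shows that any set [A] of bars has at
   least [#|A|] bars within [d]; Hall's theorem then yields the matching. *)
From HB Require Import structures.
Require Import Defs.
From mathcomp Require Import all_boot all_order all_algebra.
From mathcomp Require Import all_classical all_reals ereal.
From mathcomp Require Import lra.

Set Implicit Arguments.
Unset Strict Implicit.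
Unset Printing Implicit Defensive.

Import Order.TTheory GRing.Theory Num.Theory.

Local Open Scope classical_set_scope.
Local Open Scope ring_scope.

(** Verbose barcodes keep bars of zero length, so no diagonal absorbs unmatched bars and a matching
    has to be a bijection. Interleavings of complexes are equally rigid: inclusions of sublevel sets
    are injective and each degree is finite dimensional, so beyond the longest chain of a degree the
    interleaving maps are mutually inverse linear maps on that whole degree. Deaths are visible on
    cycles alone because a chain map sends the boundary of [y] to the boundary of the image of [y].

    In the other direction the obstacle is that singular bases are chosen separately for each
    barcode degree, so the kernel part of the chain basis used in degree [k] has no relation to the
    cycle basis used in degree [k.+1]. Chains are therefore split as a cycle plus a shortest lift of
    their boundary: the cycle is moved by the matching of its own degree, the lift by the matching
    one degree lower. Orthogonality makes both pieces no longer than the chain, so the shift by [d]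
    does not accumulate. *)

(** * Hall's marriage theorem *)

Section Hall.
Local Open Scope set_scope.
Context (I J : finType).
Implicit Types (A B : {set I}) (adj : I -> {set J}).

(** Induction on [#|A|], which is why the statement is relative to a subset; [j0] is only the value
    of [f] outside [A]. The induction splits on whether some nonempty proper subset of [A] is tight,
    that is, has no neighbour to spare. *)
Lemma hall_set (j0 : J) adj A :
  (forall B, B \subset A -> (#|B| <= #|\bigcup_(i in B) adj i|)%N) ->
  exists f : I -> J, {in A &, injective f} /\ {in A, forall i, f i \in adj i}.
Proof.
have bigcupD adj' B (K : {set J}) :
    \bigcup_(i in B) (adj' i :\: K) = (\bigcup_(i in B) adj' i) :\: K.
  apply/setP => j; rewrite inE; apply/bigcupP/andP.
    by move=> [i iB]; rewrite inE => /andP[? ?]; split=> //;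
      apply/bigcupP; exists i.
  by move=> [jK /bigcupP[i iB ji]]; exists i; rewrite // inE jK.
have [n] := ubnP #|A|; elim: n => // n IHn in adj A *.
rewrite ltnS => An hall.
have [->|/finset.set0Pn[a aA]] := eqVneq A finset.set0.
  by exists (fun=> j0); split=> i; rewrite !inE.
(* One partial matching takes its values in [K], the other outside [K], so their union is
   injective. *)
have glue B C (K : {set J}) f g : A \subset B :|: C ->
    {in B &, injective f} -> {in B, forall i, f i \in adj i :&: K} ->
    {in C &, injective g} -> {in C, forall i, g i \in adj i :\: K} ->
  exists f : I -> J, {in A &, injective f} /\ {in A, forall i, f i \in adj i}.
  move=> ABC finj fadj ginj gadj.
  exists (fun i => if i \in B then f i else g i).
  split=> [i i'|i] /(fintype.subsetP ABC).
    rewrite inE => iBC /(fintype.subsetP ABC); rewrite inE => iBC'.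
    case: ifPn iBC iBC' => /= iB iC; case: ifPn => /= iB' iC'.
    - exact: finj.
    - by move=> fg; have := gadj _ iC'; have := fadj _ iB;
         rewrite -fg !inE => /andP[_ ->].
    - by move=> fg; have := gadj _ iC; have := fadj _ iB';
         rewrite fg !inE => /andP[_ ->].
    - exact: ginj.
  rewrite inE; case: ifPn => [iB _|iB /= iC].
    by have := fadj _ iB; rewrite inE => /andP[].
  by have := gadj _ iC; rewrite inE => /andP[].
have [B /and3P[B0 BA /eqP Btight]|loose] := pickP [pred B : {set I} |
    [&& B != finset.set0, B \proper A & #|\bigcup_(i in B) adj i| == #|B|]].
  set K := \bigcup_(i in B) adj i in Btight.
  have [||f [finj fadj]] := IHn adj B.
  - exact: leq_trans (proper_card BA) An.
  - by move=> C CB; apply: hall; exact: fintype.subset_trans CB (proper_sub BA).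
  have [||g [ginj gadj]] := IHn (fun i => adj i :\: K) (A :\: B).
  - apply: leq_trans An; rewrite cardsDS ?(proper_sub BA)// ltn_subrL.
    by rewrite card_gt0 B0 /= card_gt0; apply/finset.set0Pn; exists a.
  (* Hall's condition for [C :|: B], minus the tight count of [B], leaves [#|C|] neighbours outside
     [K]. *)
  - move=> C; rewrite subsetD => /andP[CA CB]; rewrite bigcupD.
    have := hall (C :|: B).
    rewrite finset.subUset CA (proper_sub BA) => /(_ isT).
    rewrite cardsU (disjoint_setI0 CB) cards0 subn0 finset.bigcup_setU -/K.
    by rewrite -(cardsID K) finset.setIUl finset.setDUl
      finset.setDv finset.setU0
      finset.setIid (finset.setUidPr (subsetIr _ _)) Btight addnC leq_add2l.
  apply: (@glue B (A :\: B) K f g) => // [|i iB].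
    by apply/fintype.subsetP => i; rewrite !inE; case: (i \in B).
  by rewrite inE fadj//; apply/bigcupP; exists i => //; exact: fadj.
(* Without tight subsets, [a] may take any neighbour [j]: every nonempty subset of [A :\ a] has a
   neighbour to spare and survives the loss of [j]. *)
have /card_gt0P[j ja] : (0 < #|adj a|)%N.
  by have := hall [set a]; rewrite finset.sub1set aA cards1 big_set1 => ->.
have [||g [ginj gadj]] := IHn (fun i => adj i :\: [set j]) (A :\ a).
- by apply: leq_trans An; rewrite [X in (_ < X)%N](cardsD1 a) aA.
- move=> C CA; rewrite bigcupD.
  have [->|C0] := eqVneq C finset.set0; first by rewrite cards0.
  have CpA : C \proper A.
    apply: sub_proper_trans CA _; rewrite properD1//.
  have := loose C; rewrite /= C0 CpA /= => /negbT Cloose.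
  have := hall C (proper_sub CpA); rewrite leq_eqVlt eq_sym (negPf Cloose) /=.
  move=> lt; rewrite -ltnS; apply: leq_trans lt _.
  by rewrite (cardsD1 j); case: (_ \in _); rewrite ?ltnS ?add0n.
apply: (@glue [set a] (A :\ a) [set j] (fun=> j) g) => // [|i i'|i].
- by rewrite finset.setD1K.
- by rewrite !inE => /eqP -> /eqP ->.
- by rewrite !inE => /eqP ->; rewrite ja eqxx.
Qed.

Lemma hall_marriage adj :
  (forall B, (#|B| <= #|\bigcup_(i in B) adj i|)%N) ->
  exists f : I -> J, injective f /\ forall i, f i \in adj i.
Proof.
move=> hall; have [i0 _|I0] := pickP (@predT I); last first.
  have abs (i : I) : False by have := I0 i.
  by exists (fun i => match abs i with end); split=> i; case: (abs i).
have /card_gt0P[j0 _] : (0 < #|adj i0|)%N.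
  by have := hall [set i0]; rewrite cards1 big_set1.
have [f [finj fadj]] := hall_set j0 (fun B (_ : B \subset [set: I]) => hall B).
by exists f; split=> [i i'|i]; [apply: finj|apply: fadj]; rewrite inE.
Qed.

End Hall.

(** * Near matchings from matrices with one-sided bounds *)

Section NearMatching.
Context (R : realType) (F : fieldType) (I J : finType).
Context (p q : I -> R) (p' q' : J -> R) (d : R).
Context (f : J -> I -> F) (g : I -> J -> F).
Hypothesis gfK : forall i i', \sum_j g i' j * f j i = (i == i')%:R.
Hypothesis f_le : forall i j, f j i != 0 -> p' j <= p i + d /\ q' j <= q i + d.
Hypothesis g_le : forall i j, g i j != 0 -> p i <= p' j + d /\ q i <= q' j + d.

Let near i : {set J} :=
  [set j | (`|p i - p' j| <= d) && (`|q i - q' j| <= d)]%SET.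

(* If [j] contributes to the [(i', i)] entry of the product and is near neither
   [i] nor [i'], then [i'] lies strictly below [i] in the order by [p + q]. *)
Let gf_near i i' (N : {set J}) : near i \subset N -> near i' \subset N ->
  p i + q i <= p i' + q i' -> \sum_(j in N) g i' j * f j i = (i == i')%:R.
Proof.
move=> /fintype.subsetP iN /fintype.subsetP iN' le_ii'; rewrite -gfK.
rewrite [RHS](bigID (mem N)) /= [X in _ = _ + X]big1 ?addr0// => j jN.
apply/eqP; apply: contraNT jN; rewrite mulf_eq0 negb_or => /andP[].
move=> /g_le[g1 g2] /f_le[f1 f2].
have [/iN//|] := boolP (j \in near i); have [/iN'//|] := boolP (j \in near i').
rewrite !inE !ler_norml !negb_and -!ltNge.
by move=> /orP[/orP[]|/orP[]] h /orP[/orP[]|/orP[]] h'; exfalso; lra.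
Qed.

(** With fewer neighbours than elements, some nonzero combination [c] of the vectors [f _ i], [i] in
    [A], vanishes on all of [N]. Take [a] in the support of [c] with [p + q] maximal: by [gf_near],
    applying row [a] of [g] restricted to [N] returns [c 0 a], yet it must return zero. *)
Let near_hall (A : {set I}) : (#|A| <= #|(\bigcup_(i in A) near i)%SET|)%N.
Proof.
set N := (\bigcup_(i in A) near i)%SET; rewrite leqNgt; apply/negP => NA.
pose M := \matrix_(a < #|A|, b < #|N|) f (enum_val b) (enum_val a).
have /rowV0Pn[c] : kermx M != 0.
  rewrite kermx_eq0 /row_free; apply/negP => /eqP rM.
  by have := rank_leq_col M; rewrite rM leqNgt NA.
move=> /sub_kermxP cM /rV0Pn[a0 ca0].
have [a ca amax] := @arg_maxP _ R _ a0 (fun a => c 0 a != 0)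
  (fun a => p (enum_val a) + q (enum_val a)) ca0.
have near_sub i : i \in A -> near i \subset N.
  by move=> iA; exact: finset.bigcup_sup.
suff : \sum_b \sum_a' c 0 a' * (g (enum_val a) (enum_val b) * M a' b) = c 0 a.
  rewrite big1 => [ca0'|b _]; first by move: ca; rewrite -ca0' eqxx.
  under eq_bigr => a' _ do rewrite mulrCA.
  rewrite -mulr_sumr; have := congr1 (fun A : 'rV_ _ => A 0 b) cM.
  by rewrite !mxE => ->; rewrite mulr0.
rewrite exchange_big /= (bigD1 a)//= [X in _ + X]big1 ?addr0 => [|a' a'a].
  rewrite -mulr_sumr; under eq_bigr do rewrite mxE.
  rewrite -(@big_enum_val _ _ _ _ (mem N)
    (fun j => g (enum_val a) j * f j (enum_val a))).
  by rewrite gf_near ?eqxx ?mulr1// near_sub// enum_valP.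
have [->|ca'] := eqVneq (c 0 a') 0.
  by rewrite big1// => b _; rewrite mul0r.
rewrite -mulr_sumr; under eq_bigr do rewrite mxE.
rewrite -(@big_enum_val _ _ _ _ (mem N)
    (fun j => g (enum_val a) j * f j (enum_val a'))).
rewrite gf_near ?near_sub ?enum_valP//; last exact: amax.
by rewrite (inj_eq enum_val_inj) (negPf a'a) mulr0.
Qed.

Lemma near_matching : exists s : I -> J, injective s /\
  forall i, `|p i - p' (s i)| <= d /\ `|q i - q' (s i)| <= d.
Proof.
have [s [inj_s near_s]] := hall_marriage near_hall.
by exists s; split=> // i; have := near_s i; rewrite inE => /andP[].
Qed.

End NearMatching.

(** * Filtered vector spaces and orthogonal bases *)

(** A subspace of maximal dimension inside [P] exhausts [P], since adjoining the line of one more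
    vector of [P] stays inside [P]. *)
Lemma vspace_of_closed (F : fieldType) (E : vectType F) (P : set E) :
  P 0 -> (forall a x y, P x -> P y -> P (a *: x + y)) ->
  exists U : {vspace E}, forall x, x \in U <-> P x.
Proof.
move=> P0 Plin; pose D n := `[< exists U : {vspace E},
  \dim U = n /\ forall x, x \in U -> P x >].
have D0 : exists n, D n.
  exists 0; apply/asboolP; exists 0%VS; split=> [|x]; first exact: dimv0.
  by rewrite memv0 => /eqP ->.
have Dmax n : D n -> (n <= \dim {:E})%N.
  by move=> /asboolP[U [<- _]]; rewrite dimvS ?subvf.
case: (ex_maxnP D0 Dmax) => n /asboolP[U [<- UP]] Umax.
exists U => x; split=> [/UP//|Px].
have /Umax leU : D (\dim (U + <[x]>)%VS).
  apply/asboolP; exists (U + <[x]>)%VS; split=> // y.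
  by move=> /memv_addP[u /UP Pu [_ /vlineP[a ->] ->]]; rewrite addrC; exact: Plin.
have /eqP -> : U == (U + <[x]>)%VS by rewrite eqEdim addvSl leU.
exact: (subvP (addvSr _ _) _ (memv_line x)).
Qed.

Lemma separating_functional (F : fieldType) (E : vectType F) (U : {vspace E})
    (x : E) : x \notin U ->
  exists phi : 'Hom(E, F^o), phi x = 1 /\ forall u, u \in U -> phi u = 0.
Proof.
move=> xU; have fr : free (x :: vbasis U).
  by rewrite free_cons (span_basis (vbasisP U)) xU (basis_free (vbasisP U)).
have [f] := linear_of_free (x :: vbasis U) ((1 : F^o) :: nseq (\dim U) 0).
rewrite /= size_nseq size_tuple => /(_ fr erefl) [fx fU].
exists (linfun f); split=> [|u]; first by rewrite lfunE.
rewrite -{1}(span_basis (vbasisP U)) => uU; apply/eqP; rewrite -memv_ker.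
move: u uU; apply/subvP/span_subvP => u uU; rewrite memv_ker lfunE /=.
have : f u \in nseq (\dim U) 0 by rewrite -fU map_f.
by rewrite mem_nseq => /andP[].
Qed.

(** A non-Archimedean norm over the trivially valued field [F], in logarithmic form. It isolates the
    length axioms of a single degree. *)
Record is_filtration (R : realType) (F : fieldType) (E : vectType F)
    (l : E -> \bar R) : Prop := IsFiltration {
  filt_ltey : forall x, (l x < +oo)%E;
  filt_eqNy : forall x, (l x == -oo%E) = (x == 0);
  filtZ : forall a x, a != 0 -> l (a *: x) = l x;
  filtD : forall x y : E, (l (x + y)%R <= Order.max (l x) (l y))%E
}.

Lemma len_filtration (R : realType) (F : fieldType) (C : filteredComplex R F) k :
  is_filtration (@len R F C k).
Proof.
split; [exact: len_ltey|exact: len_eqNy|exact: lenZ|exact: lenD].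
Qed.

Section Filtration.
Context (R : realType) (F : fieldType) (E : vectType F) (l : E -> \bar R).
Hypothesis filt_l : is_filtration l.

Definition orth (s : seq E) : Prop :=
  forall lam : 'I_(size s) -> F,
    l (\sum_(i < size s) lam i *: s`_i) =
    \big[Order.max/-oo%E]_(i < size s | lam i != 0) l s`_i.

Lemma filt0 : l 0 = -oo%E.
Proof. by apply/eqP; rewrite filt_eqNy. Qed.

Lemma filtZ_le a x : (l (a *: x) <= l x)%E.
Proof.
by have [->|a0] := eqVneq a 0; rewrite ?scale0r ?filt0 ?leNye ?filtZ.
Qed.

Lemma filtB x y : (l (x - y)%R <= Order.max (l x) (l y))%E.
Proof.
by rewrite -scaleN1r; apply: le_trans (filtD filt_l _ _) _;
  rewrite filtZ ?oppr_eq0 ?oner_eq0.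
Qed.

Lemma filt_sum (I : Type) (r : seq I) (P : pred I) (G : I -> E) a :
  (forall i, P i -> (l (G i) <= a)%E) -> (l (\sum_(i <- r | P i) G i) <= a)%E.
Proof.
move=> Ga; elim/big_rec: _ => [|i x Pi xa]; first by rewrite filt0 leNye.
by apply: le_trans (filtD filt_l _ _) _; rewrite ge_max Ga.
Qed.

Lemma filt_EFin x : x != 0 -> l x = (fine (l x))%:E.
Proof.
move=> x0; rewrite fineK// fin_numE filt_eqNy// x0 /=.
by rewrite lt_eqF// filt_ltey.
Qed.

(** The upper bound on the length of a combination holds for every family, so orthogonality only
    says that cancellation never makes a combination shorter than a term it uses. *)
Lemma orthP s : orth s <->
  forall (lam : 'I_(size s) -> F) i, lam i != 0 ->
    (l s`_i <= l (\sum_(j < size s) lam j *: s`_j))%E.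
Proof.
split=> [os lam i lami|os lam].
  by rewrite os; apply: (@le_bigmax_cond _ _ _ _ i).
apply/le_anti/andP; split; last first.
  by apply/bigmax_leP; rewrite leNye; split=> // i /os.
apply: filt_sum => i _; have [->|lami] := eqVneq (lam i) 0.
  by rewrite scale0r filt0 leNye.
by rewrite filtZ//; apply: (@le_bigmax_cond _ _ _ _ i).
Qed.

Lemma orth_nil : orth [::].
Proof. by apply/orthP => lam []. Qed.

(** The vectors strictly shorter than [x] form a subspace that misses [x]; [phi] separates [x] from
    it. *)
Lemma filt_functional x : x != 0 ->
  exists phi : 'Hom(E, F^o),
    phi x = 1 /\ forall u, phi u != 0 -> (l x <= l u)%E.
Proof.
move=> x0; have [|a u v ux vx|U UP] :=
  @vspace_of_closed F E [set u | (l u < l x)%E].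
- by rewrite /= filt0 ltNye filt_eqNy.
- rewrite /=; apply: le_lt_trans (filtD filt_l _ _) _; rewrite gt_max vx andbT.
  exact: le_lt_trans (filtZ_le _ _) ux.
have [|phi [phix phiU]] := @separating_functional F E U x.
  by apply/negP => /UP; rewrite /= ltxx.
exists phi; split=> // u; apply: contraR; rewrite -ltNge => ux.
by apply/eqP/phiU/UP.
Qed.

(** If [v] has nonzero coefficient in [w = a *: v + t] with [t] in the kernel of [phi], then [phi w]
    is nonzero and minimality gives that [v] is no longer than [w]; hence neither is
    [t = w - a *: v]. So [v] is orthogonal to the kernel. *)
Lemma orth_basis_cons (V : {vspace E}) v s (phi : 'Hom(E, F^o)) :
  v \in V -> phi v = 1 ->
  (forall u, u \in V -> phi u != 0 -> (l v <= l u)%E) ->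
  basis_of (V :&: lker phi) s -> orth s -> basis_of V (v :: s) /\ orth (v :: s).
Proof.
move=> vV phiv vmin bs /orthP os.
have sP u : u \in <<s>>%VS -> u \in V /\ phi u = 0.
  by rewrite (span_basis bs) => /memv_capP[? /[!memv_ker]/eqP].
split.
  rewrite basisEfree free_cons (basis_free bs) andbT; apply/and3P; split.
  - by apply/negP => /sP[_]; rewrite phiv => /eqP; rewrite oner_eq0.
  - by apply/span_subvP => u; rewrite inE => /orP[/eqP->//|/memv_span/sP[]].
  rewrite /= -(size_basis (X := in_tuple s) bs) -(limg_ker_dim phi V).
  rewrite addnC -add1n leq_add2r.
  by apply: leq_trans (dimvS (subvf _)) _; rewrite dimvf.
apply/orthP => lam; set w := \sum_(_ < _) _.
pose t := \sum_(j < size s) lam (lift ord0 j) *: s`_j.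
have wE : w = lam ord0 *: v + t by rewrite /w big_ord_recl.
have ts : t \in <<s>>%VS.
  by apply: memv_suml => i _; apply/memvZ/memv_span/mem_nth/ltn_ord.
have [tV phit] := sP _ ts.
have lvw : lam ord0 != 0 -> (l v <= l w)%E.
  move=> lam0; apply: vmin; first by rewrite wE memvD ?memvZ.
  by rewrite wE linearD linearZ /= phiv phit addr0 -[_ *: _]/(_ * _) mulr1.
move=> i; case: (unliftP ord0 i) => [j ->|->] //= lamj.
apply: (le_trans (os (lam \o lift ord0) j lamj)) => /=; rewrite -/t.
have -> : t = w - lam ord0 *: v by rewrite wE addrC addKr.
apply: le_trans (filtB _ _) _; rewrite ge_max lexx /=.
have [->|/[dup] /lvw ? ?] := eqVneq (lam ord0) 0.
  by rewrite scale0r filt0 leNye.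
by rewrite filtZ.
Qed.

(** Any nonzero vector of [U] may start the basis, because [filt_functional] provides a functional
    for which it is minimal. *)
Lemma orth_basis (U : {vspace E}) : exists s, basis_of U s /\ orth s.
Proof.
have [n] := ubnP (\dim U); elim: n => // n IHn in U *; rewrite ltnS => Un.
have [->|U0] := eqVneq U 0%VS.
  by exists [::]; split; [exact: nil_basis|exact: orth_nil].
have [phi [phiv vmin]] : exists phi : 'Hom(E, F^o), phi (vpick U) = 1 /\
    forall u, phi u != 0 -> (l (vpick U) <= l u)%E.
  by apply: filt_functional; rewrite vpick0.
have [|s [bs os]] := IHn (U :&: lker phi)%VS.
  apply: leq_trans Un; rewrite ltnNge; apply/negP => leU.
  have /eqP Uphi : (U :&: lker phi)%VS == U by rewrite eqEdim capvSl.
  have := memv_pick U; rewrite -{2}Uphi memv_cap memv_ker phiv oner_eq0.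
  by rewrite andbF.
exists (vpick U :: s); apply: orth_basis_cons bs os => // [|u _].
  exact: memv_pick.
exact: vmin.
Qed.

Lemma orth_coord_le (U : {vspace E}) s (i : 'I_(size s)) x :
  basis_of U s -> orth s -> x \in U ->
  coord (in_tuple s) i x != 0 -> (l s`_i <= l x)%E.
Proof.
move=> bs /orthP os xU; rewrite {2}(coord_basis (X := in_tuple s) bs xU); exact: os.
Qed.

Lemma filt_coord_le (U : {vspace E}) s x a : basis_of U s -> x \in U ->
  (forall i : 'I_(size s), coord (in_tuple s) i x != 0 -> (l s`_i <= a)%E) ->
  (l x <= a)%E.
Proof.
move=> bs xU xa; rewrite (coord_basis (X := in_tuple s) bs xU).
apply: filt_sum => i _; have [->|/xa] := eqVneq (coord (in_tuple s) i x) 0.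
  by rewrite scale0r filt0 leNye.
by apply: le_trans; exact: filtZ_le.
Qed.

Lemma filt_basis_EFin (U : {vspace E}) s i : basis_of U s -> (i < size s)%N ->
  l s`_i = (fine (l s`_i))%:E.
Proof. by move=> bs si; rewrite -filt_EFin// (basis_not0 bs)// mem_nth. Qed.

(** At such a level the sublevel set is the whole space, so maps defined on sublevel sets become
    globally linear. *)
Lemma filt_bounded : exists T : R, forall x, (l x <= T%:E)%E.
Proof.
have [s [bs _]] := orth_basis fullv.
exists (\big[Num.max/0]_(i < size s) fine (l s`_i)) => x.
apply: (filt_coord_le bs (memvf x)) => i _.
rewrite (filt_basis_EFin bs)//.
by rewrite lee_fin; apply: (@le_bigmax_cond _ _ _ _ i).
Qed.

End Filtration.

(** * Singular value decomposition of a map of filtered spaces *)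

Section SingularValues.
Context (R : realType) (F : fieldType) (E E' : vectType F).
Context (l : E -> \bar R) (l' : E' -> \bar R) (A : 'Hom(E, E')).
Hypotheses (filt_l : is_filtration l) (filt_l' : is_filtration l').

(* Split off [v] of least length with [A v <> 0]: a functional [phi] with
   [phi (A v) = 1] vanishing on everything shorter than [A v] makes [lker phi]
   orthogonal to [A v], and minimality makes [lker (phi \o A)] orthogonal to
   [v]. *)
Lemma singular_value_decomposition (V : {vspace E}) (W : {vspace E'}) :
  (A @: V <= W)%VS ->
  exists s1 s2 s3, [/\ basis_of V (s1 ++ s2) /\ orth l (s1 ++ s2),
    basis_of W (map A s1 ++ s3) /\ orth l' (map A s1 ++ s3)
    & {subset s2 <= lker A}].
Proof.
have [n] := ubnP (\dim V); elim: n => // n IHn in V W *.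
rewrite ltnS => Vn AVW; have [e [be oe]] := orth_basis filt_l V.
have [VA|VA] := boolP (V <= lker A)%VS.
  have [s3 [b3 o3]] := orth_basis filt_l' W.
  by exists [::], e, s3; split=> // u /(basis_mem be)/(subvP VA).
have [i0 Ai0] : exists i : 'I_(size e), A e`_i != 0.
  apply/existsP; apply: contraNT VA => /existsPn Ae.
  rewrite -(span_basis be); apply/span_subvP => u /(nthP 0)[i ie <-].
  by rewrite memv_ker; have := Ae (Ordinal ie); rewrite negbK.
have [i Ai imin] :=
  @arg_minP _ _ _ i0 (fun i => A e`_i != 0) (fun i => l e`_i) Ai0.
set v := e`_i in Ai imin; have vV : v \in V by rewrite (basis_mem be)// mem_nth.
(* Orthogonality of [e] extends minimality from the basis to all of [V]: some basis element outside
   the kernel occurs in [u]. *)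
have vmin u : u \in V -> A u != 0 -> (l v <= l u)%E.
  move=> uV Au; have [j /andP[cj Aj]] : exists j : 'I_(size e),
      (coord (in_tuple e) j u != 0) && (A e`_j != 0).
    apply/existsP; apply: contraNT Au => /existsPn cA.
    rewrite (coord_basis (X := in_tuple e) be uV) linear_sum big1// => j _.
    have := cA j; rewrite negb_and !negbK linearZ /= => /orP[/eqP->|/eqP->].
      by rewrite scale0r.
    by rewrite scaler0.
  exact: le_trans (imin j Aj) (orth_coord_le filt_l be oe uV cj).
have AvW : A v \in W by apply: (subvP AVW); exact: memv_img.
have [phi [phiv phimin]] := filt_functional filt_l' Ai.
have [||s1 [s2 [s3 [[b12 o12] [b13 o13] s2A]]]] :=
    IHn (V :&: lker (phi \o A)%VF)%VS (W :&: lker phi)%VS.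
- apply: leq_trans Vn; rewrite ltnNge; apply/negP => leV.
  have /eqP Vphi : (V :&: lker (phi \o A)%VF)%VS == V by rewrite eqEdim capvSl.
  by have := vV; rewrite -Vphi memv_cap memv_ker comp_lfunE phiv oner_eq0 andbF.
- apply/subvP => _ /memv_imgP[u /memv_capP[uV uA] ->].
  rewrite memv_cap (subvP AVW) ?memv_img//=.
  by move: uA; rewrite !memv_ker comp_lfunE.
exists (v :: s1), s2, s3; split=> //=.
  apply: orth_basis_cons b12 o12 => //; first by rewrite comp_lfunE.
  move=> u uV; rewrite comp_lfunE => phiAu; apply: vmin => //.
  by apply: contraNneq phiAu => ->; rewrite linear0.
by apply: orth_basis_cons b13 o13 => // u _; exact: phimin.
Qed.

End SingularValues.

(** * Singular bases of a filtered complex *)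

Section SingularBases.
Context (R : realType) (F : fieldType) (C : filteredComplex R F).

Lemma limg_bd_cycles k : (limg (bd C k) <= cycles C k)%VS.
Proof.
case: k => [|k] /=; first exact: subvf.
by apply/subvP => _ /memv_imgP[x _ ->]; rewrite memv_ker bd_bd.
Qed.

Lemma singular_bases_exist k : exists ys xs, singular_bases (C := C) (k := k) ys xs.
Proof.
have [s1 [s2 [s3 [[b12 o12] [b13 o13] s2A]]]] := singular_value_decomposition
  (len_filtration C k.+1) (len_filtration C k) (limg_bd_cycles k).
have Ab : basis_of (limg (bd C k)) (map (bd C k) s1).
  rewrite /basis_of (catl_free (basis_free b13)) andbT -(span_basis b12).
  rewrite limg_span map_cat span_cat eq_sym; apply/eqP/addv_idPl.
  apply/span_subvP => _ /mapP[u /s2A + ->]; rewrite memv_ker => /eqP ->.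
  exact: mem0v.
have rE : \dim (limg (bd C k)) = size s1.
  by rewrite (size_basis (X := in_tuple _) Ab) size_map.
exists (s1 ++ s2), (map (bd C k) s1 ++ s3); rewrite /singular_bases rE.
rewrite drop_size_cat// !take_size_cat ?size_map//; split=> //.
(* The tail [s2] is free and lies in the kernel; rank-nullity shows that it fills the kernel. *)
rewrite basisEfree (catr_free (basis_free b12)) /=; apply/andP; split.
  exact/span_subvP.
rewrite -(leq_add2r (size s1)) -{1}rE -[lker _]capfv limg_ker_dim.
by rewrite (size_basis (X := in_tuple _) b12) size_cat addnC.
Qed.

Lemma verbose_barcodeP k : is_verbose_barcode C k (verbose_barcode C k).
Proof.
rewrite /verbose_barcode; case: xgetP => [_ -> //|none].
have [ys [xs yx]] := singular_bases_exist k.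
by case: (none _ (ex_intro _ ys (ex_intro _ xs (conj yx erefl)))).
Qed.

End SingularBases.

Section CoordinateMap.
Context (F : fieldType) (E E' : vectType F) (X : seq E).
Implicit Types e : 'I_(size X) -> E'.

Definition coord_map_fun e (x : E) : E' :=
  \sum_(i < size X) coord (in_tuple X) i x *: e i.

Lemma coord_map_is_linear e : linear (coord_map_fun e).
Proof.
move=> a x y; rewrite scaler_sumr -big_split; apply: eq_bigr => i _.
by rewrite /= scalerA -scalerDl linearP.
Qed.

HB.instance Definition _ e :=
  GRing.isLinear.Build F E E' _ (coord_map_fun e) (coord_map_is_linear e).

Definition coord_map e : 'Hom(E, E') := linfun (coord_map_fun e).

Lemma coord_mapE e x :
  coord_map e x = \sum_(i < size X) coord (in_tuple X) i x *: e i.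
Proof. by rewrite lfunE. Qed.

Lemma coord_free_seq (i j : 'I_(size X)) : free X ->
  coord (in_tuple X) i X`_j = (j == i)%:R.
Proof. exact: (coord_free (X := in_tuple X)). Qed.

End CoordinateMap.

Section SingularBasesTheory.
Context (R : realType) (F : fieldType) (C : filteredComplex R F) (k : nat).
Context (ys : seq (chain C k.+1)) (xs : seq (chain C k)).
Hypothesis sb : singular_bases ys xs.

Let r := \dim (limg (bd C k)).
Local Notation c := (coord (in_tuple xs)).

Lemma singular_rank_cycles : (r <= size xs)%N.
Proof.
have [_ [bx _] _ _ _] := sb.
by rewrite -(size_basis (X := in_tuple xs) bx) dimvS// limg_bd_cycles.
Qed.

Lemma singular_rank_chain : (r <= size ys)%N.
Proof.
have [[b_y _] _ _ _ _] := sb.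
by rewrite -(size_basis (X := in_tuple ys) b_y) -(limg_ker_dim (bd C k)) leq_addl.
Qed.

Lemma singular_bd i : (i < r)%N -> bd C k ys`_i = xs`_i.
Proof.
move=> ir; have [_ _ _ _ yx] := sb.
have := congr1 (fun s => s`_i) yx.
by rewrite (nth_map 0) ?size_takel ?singular_rank_chain// !nth_take.
Qed.

Lemma singular_bd0 i : (r <= i < size ys)%N -> bd C k ys`_i = 0.
Proof.
move=> /andP[ri iy]; have [_ _ bk _ _] := sb; apply/eqP; rewrite -memv_ker.
apply: (basis_mem bk); rewrite -(subnKC ri) -nth_drop mem_nth//.
by rewrite size_drop ltn_sub2r// (leq_ltn_trans ri).
Qed.

(** In singular bases [bd] is diagonal, with ones in the first [r] positions and zeros after. Here
    [i] and [j] are one position, typed by the two lists. *)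
Lemma coord_bd v (i : 'I_(size xs)) (j : 'I_(size ys)) : i = j :> nat ->
  (i < r)%N -> c i (bd C k v) = coord (in_tuple ys) j v.
Proof.
move=> ij ir; have [[b_y _] [bx _] _ _ _] := sb.
rewrite {1}(coord_basis (X := in_tuple ys) b_y (memvf v)) !linear_sum /= (bigD1 j)//=.
rewrite !linearZ /= singular_bd -?ij//.
rewrite (coord_free_seq i i (basis_free bx)) eqxx mulr1.
rewrite big1 ?addr0// => j' j'j; rewrite !linearZ /=.
have [j'r|rj'] := ltnP j' r; last by rewrite singular_bd0 ?rj'//= linear0 mulr0.
have j'x := leq_trans j'r singular_rank_cycles.
rewrite singular_bd// (coord_free_seq i (Ordinal j'x) (basis_free bx)).
by rewrite -val_eqE /= ij val_eqE (negPf j'j) mulr0.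
Qed.

Lemma coord_bd0 v (i : 'I_(size xs)) : (r <= i)%N -> c i (bd C k v) = 0.
Proof.
move=> ri; have [[b_y _] [bx _] _ _ _] := sb.
rewrite (coord_basis (X := in_tuple ys) b_y (memvf v)) !linear_sum big1//= => j _.
rewrite !linearZ /=; have [jr|rj] := ltnP j r; last first.
  by rewrite singular_bd0 ?rj//= linear0 mulr0.
have jx := leq_trans jr singular_rank_cycles.
rewrite singular_bd// (coord_free_seq i (Ordinal jx) (basis_free bx)).
by rewrite -val_eqE /= ltn_eqF ?mulr0// (leq_trans jr).
Qed.

(** This is how deaths are read off: an element of [xs] occurring in a boundary forces its partner
    in [ys] to occur in every chain with that boundary, and orthogonality of [ys] bounds the
    length. *)
Lemma coord_bd_le v (i : 'I_(size xs)) : c i (bd C k v) != 0 ->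
  (i < r)%N /\ (len ys`_i <= len v)%E.
Proof.
have [ir|ri] := ltnP i r; last by rewrite coord_bd0// eqxx.
have [[b_y oy] _ _ _ _] := sb.
rewrite (@coord_bd v i (Ordinal (leq_trans ir singular_rank_chain)))// => ci.
by split=> //; have := orth_coord_le (len_filtration C k.+1) b_y oy (memvf v) ci.
Qed.

(** On boundaries this is a linear section of [bd] that picks a preimage of least length; the zero
    values extend it to the remaining basis cycles. *)
Definition boundary_lift : 'Hom(chain C k, chain C k.+1) :=
  coord_map (fun i : 'I_(size xs) => if (i < r)%N then ys`_i else 0).

Lemma bd_boundary_lift v : bd C k (boundary_lift (bd C k v)) = bd C k v.
Proof.
have [_ [bx _] _ _ _] := sb; have bdv : bd C k v \in cycles C k.
  by apply: (subvP (limg_bd_cycles C k)); exact/memv_img/memvf.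
rewrite [RHS](coord_basis (X := in_tuple xs) bx bdv).
rewrite coord_mapE linear_sum; apply: eq_bigr => i _; rewrite linearZ /=.
by case: ltnP => [/singular_bd ->//|ri]; rewrite coord_bd0// !scale0r.
Qed.

Lemma len_boundary_lift u a :
  (forall i : 'I_(size xs), (i < r)%N -> c i u != 0 -> (len ys`_i <= a)%E) ->
  (len (boundary_lift u) <= a)%E.
Proof.
move=> ua; have filtC := len_filtration C k.+1.
rewrite coord_mapE; apply: filt_sum => // i _.
have [->|ci] := eqVneq (coord (in_tuple xs) i u) 0.
  by rewrite scale0r filt0// leNye.
apply: le_trans (filtZ_le filtC _ _) _; case: ifPn => [/ua|]; first exact.
by rewrite filt0// leNye.
Qed.

Lemma len_boundary_lift_bd v : (len (boundary_lift (bd C k v)) <= len v)%E.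
Proof. by apply: len_boundary_lift => i _ /coord_bd_le[]. Qed.

End SingularBasesTheory.

(** * Filtered isomorphisms from matched singular bases *)

(* The part of a filtered isomorphism supported in degrees [k] and [k.+1]: [P]
   transports cycles, and the sections [Y], [Y'] of the differentials transport
   chains modulo cycles. *)
Record level_transport (R : realType) (F : fieldType)
    (C D : filteredComplex R F) (d : R) k (P : 'Hom(chain C k, chain D k))
    (Y : 'Hom(chain C k, chain C k.+1)) (Y' : 'Hom(chain D k, chain D k.+1)) :
    Prop := LevelTransport {
  transport_cycles : forall x, P x \in cycles D k;
  len_transport : forall x, x \in cycles C k -> (len (P x) <= len x + d%:E)%E;
  bd_section : forall v, bd C k (Y (bd C k v)) = bd C k v;
  len_section : forall v, (len (Y (bd C k v)) <= len v)%E;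
  bd_section_transport : forall v, bd D k (Y' (P (bd C k v))) = P (bd C k v);
  len_section_transport : forall v,
    (len (Y' (P (bd C k v))) <= len v + d%:E)%E
}.

Section LevelTransport.
Context (R : realType) (F : fieldType) (C D : filteredComplex R F) (k : nat).
Context (ys : seq (chain C k.+1)) (xs : seq (chain C k)).
Context (ys' : seq (chain D k.+1)) (xs' : seq (chain D k)).
Hypotheses (sb : singular_bases ys xs) (sb' : singular_bases ys' xs').
Context (s : 'I_(size xs) -> 'I_(size xs')) (t : 'I_(size xs') -> 'I_(size xs)).
Hypotheses (sK : cancel s t) (tK : cancel t s).

Let r := \dim (limg (bd C k)).
Let r' := \dim (limg (bd D k)).

Definition cycle_transport := coord_map (fun i : 'I_(size xs) => xs'`_(s i)).

Lemma coord_cycle_transport x i :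
  coord (in_tuple xs') i (cycle_transport x) = coord (in_tuple xs) (t i) x.
Proof.
have [_ [bx' _] _ _ _] := sb'.
rewrite coord_mapE linear_sum (bigD1 (t i))//= linearZ /= tK.
rewrite coord_free_seq ?(basis_free bx')// eqxx mulr1 big1 ?addr0// => j jti.
rewrite linearZ /= coord_free_seq ?(basis_free bx')//.
by rewrite (can2_eq sK tK) (negPf jti) mulr0.
Qed.

Lemma cycle_transport_level (d : R) :
  (forall i : 'I_(size xs), (len xs'`_(s i) <= len xs`_i + d%:E)%E) ->
  (forall i : 'I_(size xs), (i < r)%N -> (s i < r')%N /\
     (len ys'`_(s i) <= len ys`_i + d%:E)%E) ->
  level_transport d cycle_transport
    (boundary_lift ys xs) (boundary_lift ys' xs').
Proof.
move=> hx hy; have [_ [bx ox] _ _ _] := sb; have [_ [bx' ox'] _ bi' _] := sb'.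
have filtD := len_filtration D k.
split.
- move=> x; rewrite coord_mapE; apply: memv_suml => i _.
  by rewrite memvZ// (basis_mem bx')// mem_nth.
- move=> x xZ; rewrite coord_mapE; apply: filt_sum => // i _.
  have [->|ci] := eqVneq (coord (in_tuple xs) i x) 0.
    by rewrite scale0r filt0// leNye.
  apply: le_trans (filtZ_le filtD _ _) _; apply: le_trans (hx i) _.
  by rewrite leeD2r// (orth_coord_le (len_filtration C k) bx ox xZ ci).
- exact: bd_boundary_lift.
- exact: len_boundary_lift_bd.
- move=> v.
  (* Only positions below [r] occur in a boundary, and [s] sends them below [r'], so the image is
     again a boundary. *)
  have /memv_imgP[w _ ->] : cycle_transport (bd C k v) \in limg (bd D k).
    rewrite coord_mapE; apply: memv_suml => i _.
    have [->|/(coord_bd_le sb)[ir _]] :=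
      eqVneq (coord (in_tuple xs) i (bd C k v)) 0.
      by rewrite scale0r mem0v.
    have [sir _] := hy _ ir; rewrite memvZ// (basis_mem bi')//.
    rewrite -(nth_take 0 sir) mem_nth// size_takel//.
    exact: singular_rank_cycles sb'.
  exact: bd_boundary_lift.
- move=> v; apply: len_boundary_lift => i _; rewrite coord_cycle_transport.
  move=> /(coord_bd_le sb)[tir tiv]; have [_] := hy _ tir; rewrite tK => /le_trans.
  by apply; rewrite leeD2r.
Qed.

End LevelTransport.

Lemma cycle_transportK (R : realType) (F : fieldType)
    (C D : filteredComplex R F) k (ys : seq (chain C k.+1)) (xs : seq (chain C k))
    (ys' : seq (chain D k.+1)) (xs' : seq (chain D k))
    (s : 'I_(size xs) -> 'I_(size xs')) (t : 'I_(size xs') -> 'I_(size xs)) :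
  singular_bases ys xs -> singular_bases ys' xs' -> cancel s t -> cancel t s ->
  forall x, x \in cycles C k -> cycle_transport t (cycle_transport s x) = x.
Proof.
move=> sb sb' sK tK x xZ; have [_ [bx _] _ _ _] := sb.
rewrite [RHS](coord_basis (X := in_tuple xs) bx xZ) coord_mapE (reindex s) /=.
  by apply: eq_bigr => i _; rewrite (coord_cycle_transport sb' sK tK) sK.
by exists t => i _; [exact: sK|exact: tK].
Qed.

Section ChainTransport.
Context (R : realType) (F : fieldType) (C D : filteredComplex R F) (d : R).
Context (P : forall k, 'Hom(chain C k, chain D k)).
Context (Y : forall k, 'Hom(chain C k, chain C k.+1)).
Context (Y' : forall k, 'Hom(chain D k, chain D k.+1)).
Hypothesis PY : forall k, level_transport d (P k) (Y k) (Y' k).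

(** The summand [v - Y (bd v)] is a cycle and moves by the map of its own degree; the lift
    [Y (bd v)] is replaced by the lift of the transported boundary. In degree zero every chain is a
    cycle. *)
Definition chain_transport k : chain C k -> chain D k :=
  match k with
  | 0 => P 0
  | k'.+1 => fun v =>
      P k'.+1 (v - Y k' (bd C k' v)) + Y' k' (P k' (bd C k' v))
  end.

Lemma chain_transport_linear k a x y :
  chain_transport (k := k) (a *: x + y) = a *: chain_transport x + chain_transport y.
Proof.
case: k x y => [|k] x y /=; first exact: linearP.
rewrite linearP linearP /= opprD addrACA -scalerBr linearP linearP /= linearP.
by rewrite scalerDr addrACA.
Qed.

Lemma section_cycle k v : v - Y k (bd C k v) \in cycles C k.+1.
Proof. by rewrite /= memv_ker linearB /= (bd_section (PY k)) subrr. Qed.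

Lemma bd_cycle k v : bd C k v \in cycles C k.
Proof. by apply: (subvP (limg_bd_cycles C k)); exact/memv_img/memvf. Qed.

Lemma bd_chain_transport k v :
  bd D k (chain_transport v) = P k (bd C k v).
Proof.
rewrite /= linearD /= (bd_section_transport (PY k)).
by have := transport_cycles (PY k.+1) (v - Y k (bd C k v));
  rewrite /= memv_ker => /eqP ->; rewrite add0r.
Qed.

Lemma chain_transport_bd k v :
  chain_transport (bd C k v) = P k (bd C k v).
Proof.
by case: k v => [|k] v //=; rewrite bd_bd !linear0 !addr0.
Qed.

Lemma len_chain_transport k (x : chain C k) :
  (len (chain_transport x) <= len x + d%:E)%E.
Proof.
case: k x => [|k] x /=; first by apply: (len_transport (PY 0)); exact: memvf.
apply: le_trans (lenD _ _) _; rewrite ge_max (len_section_transport (PY k)) andbT.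
apply: le_trans (len_transport (PY k.+1) (section_cycle x)) _; rewrite leeD2r//.
apply: le_trans (filtB (len_filtration C k.+1) _ _) _.
by rewrite ge_max lexx (len_section (PY k)).
Qed.

End ChainTransport.

(** The splitting is respected: the transported chain has boundary [P (bd v)], so its lift part is
    exactly the second summand, and what remains is the transported cycle. *)
Lemma chain_transportK (R : realType) (F : fieldType) (C D : filteredComplex R F)
    (d : R) (P : forall k, 'Hom(chain C k, chain D k))
    (Y : forall k, 'Hom(chain C k, chain C k.+1))
    (P' : forall k, 'Hom(chain D k, chain C k))
    (Y' : forall k, 'Hom(chain D k, chain D k.+1)) :
  (forall k, level_transport d (P k) (Y k) (Y' k)) ->
  (forall k x, x \in cycles C k -> P' k (P k x) = x) ->
  forall k (x : chain C k),
    chain_transport P' Y' Y (chain_transport P Y Y' x) = x.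
Proof.
move=> PY PK [|k] x; first by rewrite /= PK// memvf.
rewrite [LHS]/= (bd_chain_transport PY) PK ?bd_cycle// /= addrK.
by rewrite PK ?(section_cycle PY)// subrK.
Qed.

Lemma interleaved_transport (R : realType) (F : fieldType)
    (C D : filteredComplex R F) (d : R) (P : forall k, 'Hom(chain C k, chain D k))
    (Y : forall k, 'Hom(chain C k, chain C k.+1))
    (P' : forall k, 'Hom(chain D k, chain C k))
    (Y' : forall k, 'Hom(chain D k, chain D k.+1)) :
  (forall k, level_transport d (P k) (Y k) (Y' k)) ->
  (forall k, level_transport d (P' k) (Y' k) (Y k)) ->
  (forall k x, x \in cycles C k -> P' k (P k x) = x) ->
  (forall k x, x \in cycles D k -> P k (P' k x) = x) ->
  interleaved C D d.
Proof.
have shift_transport (A B : filteredComplex R F)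
    (Q : forall k, 'Hom(chain A k, chain B k)) Z Z' :
    (forall k, level_transport d (Q k) (Z k) (Z' k)) ->
    shift_family d (fun=> chain_transport Q Z Z').
  move=> QZ; split=> // t; split=> [k x xt|k a x y _ _|k x _].
  - rewrite /sublevel /= EFinD; apply: le_trans (len_chain_transport QZ x) _.
    by rewrite leeD2r.
  - exact: chain_transport_linear.
  - by rewrite (bd_chain_transport QZ) chain_transport_bd.
move=> PY PY' PK P'K.
(* The maps are defined on all chains and do not depend on the level, so they commute with the
   inclusions. *)
exists (fun=> chain_transport P Y Y'), (fun=> chain_transport P' Y' Y); split.
- exact: shift_transport.
- exact: shift_transport.
- by move=> t k x _; exact: chain_transportK.
- by move=> t k y _; exact: chain_transportK.
Qed.

(** * Matchings of bars *)

Section MatchingDistance.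
Context (R : realType).
Implicit Types (A B : seq (\bar R * \bar R)) (d : R).

(** The sizes enter through equations so that bars can be indexed by the positions of the cycle
    bases. *)
Lemma matching_dist_le A B n m d (sA : size A = n) (sB : size B = m)
    (s : 'I_n -> 'I_m) : 0 <= d -> bijective s ->
  (forall i : 'I_n,
    (bar_dist (nth (0%E, 0%E) A i) (nth (0%E, 0%E) B (s i)) <= d%:E)%E) ->
  (matching_dist A B <= d%:E)%E.
Proof.
move=> d0 bij_s sd; apply: ge_ereal_inf.
case: n / sA in s bij_s sd *; case: m / sB in s bij_s sd *.
eexists; first by exists s; split.
by apply: bigmax_le => // i _; rewrite !(tnth_nth (0%E, 0%E)).
Qed.

(** The strict inequality is what extracts an actual matching from the infimum. *)
Lemma matching_dist_ltP A B n m d (sA : size A = n) (sB : size B = m) :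
  (matching_dist A B < d%:E)%E -> exists s : 'I_n -> 'I_m, bijective s /\
  forall i : 'I_n,
    (bar_dist (nth (0%E, 0%E) A i) (nth (0%E, 0%E) B (s i)) <= d%:E)%E.
Proof.
case: n / sA; case: m / sB => /ereal_inf_lt[_ [s [bij_s ->]] /ltW sd].
exists s; split=> // i; apply: le_trans sd.
have := @le_bigmax_cond _ _ _ 0%E i predT (fun i =>
  bar_dist (tnth (in_tuple A) i) (tnth (in_tuple B) (s i))) isT.
by rewrite !(tnth_nth (0%E, 0%E)).
Qed.

Lemma matching_dist_ge0 A B : (0 <= matching_dist A B)%E.
Proof. by apply/ereal_infP => _ [s [_ ->]]; exact: bigmax_ge_id. Qed.

(** The booleans tell whether the deaths are finite, in the format of [verbose_barcode_bases]. *)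
Lemma bar_dist_leP (p q p' q' d : R) (b b' : bool) :
  (bar_dist (p%:E, if b then q%:E else +oo) (p'%:E, if b' then q'%:E else +oo)
     <= d%:E)%E <-> [/\ b = b', `|p - p'| <= d & b -> `|q - q'| <= d].
Proof.
rewrite /bar_dist /=; case: b b' => [] []; rewrite /= ?ltry ?ltxx ?eqxx /=.
- rewrite ge_max !lee_fin; split=> [/andP[]//|[_ -> /(_ isT) ->]//].
- by split=> [|[]].
- by split=> [|[]].
- by rewrite lee_fin; split=> [|[]].
Qed.

End MatchingDistance.

(** * The isometry theorem for filtered complexes *)

Section Isometry.
Context (R : realType) (F : fieldType).
Implicit Types (C D : filteredComplex R F) (d : R).

Lemma verbose_barcode_bases C k :
  exists (ys : seq (chain C k.+1)) (xs : seq (chain C k)),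
  [/\ singular_bases ys xs, size (verbose_barcode C k) = size xs
    & forall i, (i < size xs)%N -> nth (0%E, 0%E) (verbose_barcode C k) i =
      ((fine (len xs`_i))%:E,
       if (i < \dim (limg (bd C k)))%N then (fine (len ys`_i))%:E else +oo%E)].
Proof.
have [ys [xs [sb ->]]] := verbose_barcodeP C k; exists ys, xs.
have [[b_y _] [bx _] _ _ _] := sb; set r := \dim _.
have [rx ry] : (r <= size xs)%N /\ (r <= size ys)%N.
  by split; [exact: singular_rank_cycles sb|exact: singular_rank_chain sb].
have sz : size (zip (take r xs) (take r ys)) = r.
  by rewrite size_zip !size_takel ?minnn.
split=> // [|i ix]; first by rewrite size_cat !size_map sz size_drop subnKC.
have lenx := filt_basis_EFin (len_filtration C k) bx ix.
rewrite nth_cat size_map sz; case: ifPn => [ir|/[!ltnNge] /[!negbK] ri].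
  rewrite (nth_map (0, 0)) ?sz// nth_zip ?size_takel//= !nth_take// -lenx.
  congr (_, _).
  exact: (filt_basis_EFin (len_filtration C k.+1) b_y (leq_trans ir ry)).
rewrite (nth_map 0) ?size_drop ?ltn_sub2r ?(leq_ltn_trans ri)//.
by rewrite nth_drop subnKC// -lenx.
Qed.

Lemma level_transport_of_matching C D d k :
  (matching_dist (verbose_barcode C k) (verbose_barcode D k) < d%:E)%E ->
  exists (P : 'Hom(chain C k, chain D k)) (P' : 'Hom(chain D k, chain C k)) Y Y',
  [/\ level_transport d P Y Y', level_transport d P' Y' Y,
      forall x, x \in cycles C k -> P' (P x) = x
    & forall x, x \in cycles D k -> P (P' x) = x].
Proof.
have [ys [xs [sb sC bC]]] := verbose_barcode_bases C k.
have [ys' [xs' [sb' sD bD]]] := verbose_barcode_bases D k.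
move=> /(matching_dist_ltP sC sD)[s [[t sK tK] sd]].
set r := \dim (limg (bd C k)) in bC; set r' := \dim (limg (bd D k)) in bD.
have {}sd (i : 'I_(size xs)) : [/\ (i < r)%N = (s i < r')%N,
    `|fine (len xs`_i) - fine (len xs'`_(s i))| <= d
  & (i < r)%N -> `|fine (len ys`_i) - fine (len ys'`_(s i))| <= d].
  by apply/bar_dist_leP; rewrite -bC// -bD//.
have near x y : `|x - y| <= d ->
    (x%:E <= y%:E + d%:E)%E /\ (y%:E <= x%:E + d%:E)%E.
  by rewrite -!EFinD !lee_fin ler_norml => /andP[? ?]; split; lra.
have [[b_y _] [bx _] _ _ _] := sb; have [[b_y' _] [bx' _] _ _ _] := sb'.
have [ry ry'] := (singular_rank_chain sb, singular_rank_chain sb').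
have lenx := filt_basis_EFin (len_filtration C k) bx.
have lenx' := filt_basis_EFin (len_filtration D k) bx'.
have leny i : (i < r)%N -> len ys`_i = (fine (len ys`_i))%:E.
  move=> ir; apply: (filt_basis_EFin (len_filtration C k.+1) b_y).
  exact: leq_trans ir ry.
have leny' i : (i < r')%N -> len ys'`_i = (fine (len ys'`_i))%:E.
  move=> ir; apply: (filt_basis_EFin (len_filtration D k.+1) b_y').
  exact: leq_trans ir ry'.
exists (cycle_transport s), (cycle_transport t).
exists (boundary_lift ys xs), (boundary_lift ys' xs'); split.
- apply: (cycle_transport_level sb sb' sK tK) => i; have [rr px py] := sd i.
    by rewrite lenx// lenx'//; case: (near _ _ px).
  move=> ir; have ir' : (s i < r')%N by rewrite -rr.
  by split=> //; rewrite leny// leny'//; case: (near _ _ (py ir)).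
- apply: (cycle_transport_level sb' sb tK sK) => i.
    have [_ + _] := sd (t i); rewrite tK => px.
    by rewrite lenx// lenx'//; case: (near _ _ px).
  move=> ir'; have [+ _] := sd (t i); rewrite tK => rr py.
  have ir : (t i < r)%N by rewrite rr.
  by split=> //; rewrite leny// leny'//; case: (near _ _ (py ir)).
- exact: (cycle_transportK sb sb' sK tK).
- exact: (cycle_transportK sb' sb tK sK).
Qed.

Lemma interleaved_of_matching C D d :
  (forall k,
    matching_dist (verbose_barcode C k) (verbose_barcode D k) < d%:E)%E ->
  interleaved C D d.
Proof.
move=> md; have lt k := level_transport_of_matching (md k).
(* The existence statement is nested, so its four maps are chosen one after another, each for all
   degrees at once. *)
pose P k := projT1 (cid (lt k)); pose ltP k := projT2 (cid (lt k)).
pose P' k := projT1 (cid (ltP k)); pose ltP' k := projT2 (cid (ltP k)).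
pose Y k := projT1 (cid (ltP' k)); pose ltY k := projT2 (cid (ltP' k)).
pose Y' k := projT1 (cid (ltY k)).
have H k : [/\ level_transport d (P k) (Y k) (Y' k),
    level_transport d (P' k) (Y' k) (Y k),
    forall x, x \in cycles C k -> P' k (P k x) = x
  & forall x, x \in cycles D k -> P k (P' k x) = x] := projT2 (cid (ltY k)).
by apply: (@interleaved_transport _ _ _ _ _ P Y P' Y') => // k; case: (H k).
Qed.

(* Compatibility of the family makes its member at a large enough [T] lengthen
   every chain by at most [d]. *)
Lemma shift_family_large C D d (f : R -> forall k, chain C k -> chain D k) k T :
  shift_family d f -> (forall x : chain C k, (len x <= T%:E)%E) ->
  exists2 h : 'Hom(chain C k, chain D k), h =1 @f T k &
    forall x, (len (h x) <= len x + d%:E)%E.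
Proof.
move=> [fmap fcomp] lenT; have [fsub flin fbd] := fmap T.
have lin : linear (@f T k) by move=> a x y; apply: flin; exact: lenT.
pose lf : {linear chain C k -> chain D k} :=
  HB.pack (@f T k) (GRing.isLinear.Build _ _ _ _ _ lin).
exists (linfun lf) => [x|x]; first by rewrite lfunE.
rewrite lfunE /=; have [->|x0] := eqVneq x 0.
  have -> : f T k 0 = 0 := linear0 lf.
  by rewrite (filt0 (len_filtration D k)) leNye.
have lx := filt_EFin (len_filtration C k) x0.
have sT : fine (len x) <= T by rewrite -lee_fin -lx.
rewrite (fcomp _ _ _ _ sT) /sublevel /= -?lx// {2}lx -EFinD.
by have [+ _ _] := fmap (fine (len x)); apply; rewrite /sublevel /= -lx.
Qed.

(** What the barcode in degree [k] sees of an interleaving: births through [phi0], deaths through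
    [phi1]. *)
Record level_map C D d k (phi0 : 'Hom(chain C k, chain D k))
    (phi1 : 'Hom(chain C k.+1, chain D k.+1)) : Prop := LevelMap {
  level_map_cycles : forall x, x \in cycles C k -> phi0 x \in cycles D k;
  level_map_bd : forall v, phi0 (bd C k v) = bd D k (phi1 v);
  len_level_map0 : forall x, (len (phi0 x) <= len x + d%:E)%E;
  len_level_map1 : forall v, (len (phi1 v) <= len v + d%:E)%E
}.

Lemma shift_family_level_map C D d (f : R -> forall k, chain C k -> chain D k) k T :
  shift_family d f -> (forall x : chain C k, (len x <= T%:E)%E) ->
  (forall x : chain C k.+1, (len x <= T%:E)%E) ->
  exists (phi0 : 'Hom(chain C k, chain D k))
    (phi1 : 'Hom(chain C k.+1, chain D k.+1)),
    phi0 =1 @f T k /\ level_map d phi0 phi1.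
Proof.
move=> ff T0 T1; have [phi0 phi0E len0] := shift_family_large ff T0.
have [phi1 phi1E len1] := shift_family_large ff T1.
have [fmap _] := ff; have [_ flin fbd] := fmap T.
exists phi0, phi1; split=> //; split=> // [x|v]; last first.
  by rewrite phi0E phi1E; apply: fbd; exact: T1.
case: k => [|k] /= in phi0 phi0E x T0 T1 phi1 phi1E len0 len1 *.
  by move=> _; exact: memvf.
rewrite !memv_ker phi0E => /eqP bdx; rewrite -fbd; last exact: T0.
(* [T] is not assumed to bound this lower degree, so [f T] sending zero to zero comes from linearity
   on the sublevel set, applied to [1 *: 0 + 0]. *)
have sub0 : sublevel (C := C) T (0 : chain C k).
  by rewrite /sublevel /= (filt0 (len_filtration C k)) leNye.
rewrite bdx; have := flin k 1 0 0 sub0 sub0; rewrite scaler0 addr0 scale1r.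
by move=> /eqP; rewrite -[X in X == _]addr0 (inj_eq (addrI _)) eq_sym.
Qed.

(** At a level [T] bounding both degrees of both complexes, compatibility identifies the maps at
    [T + d] with those at [T], so the interleaving identities become genuine inverses. *)
Lemma interleaved_level_map C D d k : 0 <= d -> interleaved C D d ->
  exists (phi0 : 'Hom(chain C k, chain D k))
         (phi1 : 'Hom(chain C k.+1, chain D k.+1))
         (psi0 : 'Hom(chain D k, chain C k))
         (psi1 : 'Hom(chain D k.+1, chain C k.+1)),
  [/\ level_map d phi0 phi1, level_map d psi0 psi1,
      cancel phi0 psi0 & cancel psi0 phi0].
Proof.
move=> d0 [f [g [ff gg gfK fgK]]].
have [TC TCle] := filt_bounded (len_filtration C k).
have [TC' TCle'] := filt_bounded (len_filtration C k.+1).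
have [TD TDle] := filt_bounded (len_filtration D k).
have [TD' TDle'] := filt_bounded (len_filtration D k.+1).
pose T := Num.max (Num.max TC TC') (Num.max TD TD').
have [hC hC' hD hD'] : [/\ forall x : chain C k, (len x <= T%:E)%E,
    forall x : chain C k.+1, (len x <= T%:E)%E,
    forall x : chain D k, (len x <= T%:E)%E
  & forall x : chain D k.+1, (len x <= T%:E)%E].
  by split=> x; [apply: le_trans (TCle x) _|apply: le_trans (TCle' x) _|
    apply: le_trans (TDle x) _|apply: le_trans (TDle' x) _];
    rewrite lee_fin /T !le_max lexx ?orbT.
have [phi0 [phi1 [phi0E phiL]]] := shift_family_level_map ff hC hC'.
have [psi0 [psi1 [psi0E psiL]]] := shift_family_level_map gg hD hD'.
have Td : T <= T + d by rewrite lerDl.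
exists phi0, phi1, psi0, psi1; split=> // x; rewrite psi0E phi0E.
- by have [_ gcomp] := gg; rewrite -(gcomp _ _ _ _ Td (hD _)); apply/gfK/hC.
- by have [_ fcomp] := ff; rewrite -(fcomp _ _ _ _ Td (hC _)); apply/fgK/hD.
Qed.

(** The birth bound is orthogonality of [xs']. For the death, the image of the [i]-th cycle is the
    boundary of [phi1] applied to the [i]-th element of [ys], and [coord_bd_le] applies. *)
Lemma level_map_coord C D d k (phi0 : 'Hom(chain C k, chain D k)) phi1
    (ys : seq (chain C k.+1)) (xs : seq (chain C k))
    (ys' : seq (chain D k.+1)) (xs' : seq (chain D k)) i (j : 'I_(size xs')) :
  singular_bases ys xs -> singular_bases ys' xs' -> level_map d phi0 phi1 ->
  (i < size xs)%N -> coord (in_tuple xs') j (phi0 xs`_i) != 0 ->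
  (len xs'`_j <= len xs`_i + d%:E)%E /\
  ((i < \dim (limg (bd C k)))%N -> (j < \dim (limg (bd D k)))%N /\
    (len ys'`_j <= len ys`_i + d%:E)%E).
Proof.
move=> sb sb' L ix cj; have [_ [bx _] _ _ _] := sb; have [_ [bx' ox'] _ _ _] := sb'.
have xZ : phi0 xs`_i \in cycles D k.
  by apply: (level_map_cycles L); rewrite (basis_mem bx) ?mem_nth.
split=> [|ir].
  apply: le_trans (len_level_map0 L _).
  exact: (orth_coord_le (len_filtration D k) bx' ox' xZ cj).
move: cj; rewrite -(singular_bd sb ir) (level_map_bd L) => /(coord_bd_le sb')[jr lj].
by split=> //; apply: le_trans lj _; exact: (len_level_map1 L).
Qed.

(** Used for the map from [D] back to [C], it compares the numbers of bars and so makes the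
    injection from Hall's theorem bijective. *)
Lemma level_map_dim C D d k (phi0 : 'Hom(chain C k, chain D k)) phi1 psi0 :
  level_map d phi0 phi1 -> cancel phi0 psi0 ->
  (\dim (cycles C k) <= \dim (cycles D k))%N.
Proof.
move=> L phiK; have ker0 : (cycles C k :&: lker phi0 = 0)%VS.
  by have /lker0P/eqP -> := can_inj phiK; exact: capv0.
rewrite -(limg_dim_eq ker0) dimvS//; apply/subvP => _ /memv_imgP[x xZ ->].
exact: (level_map_cycles L xZ).
Qed.

Lemma coord_comp C D k (xs : seq (chain C k)) (xs' : seq (chain D k))
    (phi : 'Hom(chain C k, chain D k)) (psi : 'Hom(chain D k, chain C k))
    (i i' : 'I_(size xs)) :
  basis_of (cycles C k) xs -> basis_of (cycles D k) xs' ->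
  (forall x, x \in cycles C k -> phi x \in cycles D k) -> cancel phi psi ->
  \sum_(j < size xs') coord (in_tuple xs) i' (psi xs'`_j) *
    coord (in_tuple xs') j (phi xs`_i)
    = (i == i')%:R.
Proof.
move=> bx bx' phiZ phiK; rewrite -(coord_free_seq i' i (basis_free bx)).
have xZ : phi xs`_i \in cycles D k by rewrite phiZ// (basis_mem bx)// mem_nth.
rewrite -[in RHS](phiK xs`_i) [in RHS](coord_basis (X := in_tuple xs') bx' xZ).
by rewrite !linear_sum; apply: eq_bigr => j _; rewrite !linearZ mulrC.
Qed.

Lemma matching_of_interleaved C D d k : 0 <= d -> interleaved C D d ->
  (matching_dist (verbose_barcode C k) (verbose_barcode D k) <= d%:E)%E.
Proof.
move=> d0 /(interleaved_level_map k d0)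
  [phi0 [phi1 [psi0 [psi1 [phiL psiL phiK psiK]]]]].
have [ys [xs [sb sC bC]]] := verbose_barcode_bases C k.
have [ys' [xs' [sb' sD bD]]] := verbose_barcode_bases D k.
have [[b_y _] [bx _] _ _ _] := sb; have [[b_y' _] [bx' _] _ _ _] := sb'.
have [ry ry'] := (singular_rank_chain sb, singular_rank_chain sb').
have [TC TCle] := filt_bounded (len_filtration C k.+1).
have [TD TDle] := filt_bounded (len_filtration D k.+1).
set r := \dim (limg (bd C k)) in bC ry *; set r' := \dim (limg (bd D k)) in bD ry' *.
(* A finite stand-in for the death time [+oo], out of reach of the others. *)
pose M := Num.max TC TD + d + 1.
pose p i := fine (len xs`_i); pose p' j := fine (len xs'`_j).
pose q i := if (i < r)%N then fine (len ys`_i) else M.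
pose q' j := if (j < r')%N then fine (len ys'`_j) else M.
have lenE := filt_basis_EFin (len_filtration C k) bx.
have lenE' := filt_basis_EFin (len_filtration D k) bx'.
have lenY i : (i < r)%N -> len ys`_i = (fine (len ys`_i))%:E.
  move=> ir; apply: (filt_basis_EFin (len_filtration C k.+1) b_y).
  exact: leq_trans ir ry.
have lenY' i : (i < r')%N -> len ys'`_i = (fine (len ys'`_i))%:E.
  move=> ir; apply: (filt_basis_EFin (len_filtration D k.+1) b_y').
  exact: leq_trans ir ry'.
have yM i : (i < r)%N -> fine (len ys`_i) + d < M.
  move=> ir; have : fine (len ys`_i) <= Num.max TC TD.
    by rewrite le_max -lee_fin -lenY// TCle.
  by rewrite /M; lra.
have yM' i : (i < r')%N -> fine (len ys'`_i) + d < M.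
  move=> ir; have : fine (len ys'`_i) <= Num.max TC TD.
    by rewrite le_max -(lee_fin _ TD) -lenY'// TDle orbT.
  by rewrite /M; lra.
have [s [inj_s sd]] : exists s : 'I_(size xs) -> 'I_(size xs'), injective s /\
    forall i : 'I_(size xs), `|p i - p' (s i)| <= d /\ `|q i - q' (s i)| <= d.
  apply: (@near_matching _ F _ _ (p \o val) (q \o val) (p' \o val) (q' \o val) d
    (fun j (i : 'I_(size xs)) => coord (in_tuple xs') j (phi0 xs`_i))
    (fun i (j : 'I_(size xs')) => coord (in_tuple xs) i (psi0 xs'`_j)))
    => [i i'|i j|i j] /=.
  - exact: (coord_comp _ _ bx bx' (level_map_cycles phiL) phiK).
  - move=> /(level_map_coord sb sb' phiL (ltn_ord i))[].
    rewrite lenE// lenE'// -EFinD lee_fin => pij qij; split=> //.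
    rewrite /q /q'; case: (boolP (i < r)%N) => [ir|_].
      have [jr] := qij ir.
      by rewrite [X in if X then _ else _]jr lenY// lenY'// -EFinD lee_fin.
    by case: ifPn => [/yM'|_]; lra.
  - move=> /(level_map_coord sb' sb psiL (ltn_ord j))[].
    rewrite lenE// lenE'// -EFinD lee_fin => pij qij; split=> //.
    rewrite /q /q'; case: (boolP (j < r')%N) => [ir|_].
      have [jr] := qij ir.
      by rewrite [X in if X then _ else _]jr lenY// lenY'// -EFinD lee_fin.
    by case: ifPn => [/yM|_]; lra.
have bij_s : bijective s.
  apply: inj_card_bij inj_s _; rewrite !card_ord.
  rewrite -(size_basis (X := in_tuple xs) bx) -(size_basis (X := in_tuple xs') bx').
  exact: level_map_dim psiL psiK.
apply: (matching_dist_le sC sD d0 bij_s) => i; rewrite bC// bD//.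
have [pd qd] := sd i; apply/bar_dist_leP; split=> //.
  (* Finite deaths lie more than [d] below [M], so bars with [q] and [q'] within [d] are both finite
     or both infinite. *)
  move: qd; rewrite /q /q' ler_norml.
  by case: ifPn => [/yM|_]; case: ifPn => [/yM'|_] // ? /andP[? ?]; exfalso; lra.
move=> ir; move: qd; rewrite /q /q' ir ler_norml; case: ifPn => [sr|_].
  by rewrite ler_norml.
by have := yM _ ir; move=> ? /andP[? ?]; exfalso; lra.
Qed.

Theorem interleaving_isometry C D :
  ereal_sup (range (fun k =>
    matching_dist (verbose_barcode C k) (verbose_barcode D k))) =
  interleaving_dist C D.
Proof.
set S := ereal_sup _; apply/le_anti/andP; split.
  apply/ereal_infP => _ [d [d0 CDd] <-]; apply: ge_ereal_sup => _ [k _ <-].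
  exact: matching_of_interleaved.
have Sk k : (matching_dist (verbose_barcode C k) (verbose_barcode D k) <= S)%E.
  by apply: ereal_sup_ubound; exists k.
have S0 : (0 <= S)%E by apply: le_trans (Sk 0%N); exact: matching_dist_ge0.
case: S Sk S0 => [S||] Sk S0; [|by rewrite leey|by []].
(* The supremum may equal a matching distance, while a strict bound is required; the same [e] serves
   all degrees. *)
apply/lee_addgt0Pr => e e0; apply: ge_ereal_inf; exists (S + e)%:E => //.
have Se : 0 <= S + e by rewrite addr_ge0// ltW.
exists (S + e) => //; split=> //; apply: interleaved_of_matching => k.
by apply: le_lt_trans (Sk k) _; rewrite lte_fin ltrDl.
Qed.

End Isometry.

Theorem corollary1p2 (R : realType) (F : fieldType) (X Y : finPseudoMetric R)
    (metric_X : is_metric X) (metric_Y : is_metric Y) :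
  let dM_barcodes k (T : tripod X Y) : \bar R :=
    matching_dist (verbose_barcode (vr_complex F (pullbackX T)) k)
                  (verbose_barcode (vr_complex F (pullbackY T)) k) in
  let sup_inf := ereal_sup (range (fun k => tripod_inf (dM_barcodes k))) in
  let inf_sup :=
    tripod_inf (fun T => ereal_sup (range (fun k => dM_barcodes k T))) in
  [/\ ereal_sup (range (pullback_bottleneck_dist F X Y)) = sup_inf,
      (sup_inf <= inf_sup)%E
    & inf_sup = pullback_interleaving_dist F X Y].
Proof.
move=> dM_barcodes sup_inf inf_sup; split=> //.
  (* The general inequality between sup-inf and inf-sup, through the value at a single [k] and
     [T]. *)
  apply: ge_ereal_sup => _ [k _ <-]; apply/ereal_infP => _ [T <-].
  apply: (@le_trans _ _ (dM_barcodes k T)).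
    by apply: ereal_inf_lbound; exists T.
  by apply: ereal_sup_ubound; exists k.
(* The two functions of the tripod agree pointwise, before any infimum is taken. *)
rewrite /inf_sup /pullback_interleaving_dist; congr tripod_inf.
by apply/funext => T; exact: interleaving_isometry.
Qed.
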